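(* Let $0<p<\infty$, $u=\chi_{[0,1]}$ and $v\equiv1$ on $\mathbb{R}_+$. Then $\Lambda_2^p(uv)$ is strictly contained in $\Lambda^p(u)[\Lambda^p(v)]$, and $\Lambda_2^p(uv)\not\subset\Lambda^p(v)[\Lambda^p(u)]$. Consequently, no two of the three spaces $\Lambda_2^p(uv)$, $\Lambda^p(u)[\Lambda^p(v)]$ and $\Lambda^p(v)[\Lambda^p(u)]$ are equal.
   Context: For a measurable function $h$ on $\mathbb{R}$, $h^*(t)=\inf\{\sigma:|\{x:|h(x)|>\sigma\}|\le t\}$, $t>0$. For measurable $f:\mathbb{R}^2\to\mathbb{R}$, written $f(x,y)$, $f_y^*(x,t)$ is the decreasing rearrangement of $f(x,\cdot)$ evaluated at $t$ (with $x$ fixed), a subscript $x$ on a star denotes the decreasing rearrangement with respect to the first variable, and $f^*_{yx}(s,t)=(f_y^*(\cdot,t))^*_x(s)$. For weights (non-negative locally integrable functions) $a,b$ on $\mathbb{R}_+=(0,\infty)$, $\Lambda_2^p(ab)$ is the set of measurable $f:\mathbb{R}^2\to\mathbb{R}$ with $\left(\int_0^\infty\int_0^\infty(f^*_{yx}(s,t))^pa(s)b(t)\,ds\,dt\right)^{1/p}<\infty$, and $\Lambda^p(a)[\Lambda^p(b)]$ is the set of measurable $f:\mathbb{R}^2\to\mathbb{R}$ with $$\left(\int_0^\infty\left(\int_0^\infty(f_y^*(\cdot,t))^pb(t)\,dt\right)^*_x(s)\,a(s)\,ds\right)^{1/p}<\infty.$$ *)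

(* Defs.v *)
From HB Require Import structures.
From mathcomp Require Import all_boot all_order all_algebra.
From mathcomp Require Import all_classical all_reals all_analysis.
From mathcomp Require Import measurable_realfun.

Set Implicit Arguments.
Unset Strict Implicit.
Unset Printing Implicit Defensive.

Import Order.TTheory GRing.Theory Num.Theory.
Import numFieldNormedType.Exports.

Local Open Scope classical_set_scope.
Local Open Scope ring_scope.
Local Open Scope ereal_scope.

Section Rearrangements.
Context {R : realType}.
Local Notation mu := (@lebesgue_measure R).

(* Values in [-oo, +oo] are allowed because iterated rearrangements may be
   infinite.  On every set of reals, measurable or not, [lebesgue_measure] is
   the Lebesgue outer measure; hence [decreasing_rearrangement] has the usual
   meaning for Lebesgue measurable [h], and does not depend on the values of
   [h] on a null set.  A negative [sigma] never belongs to the set, whose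
   infimum is +oo when it is empty. *)
Definition decreasing_rearrangement (h : R -> \bar R) (t : R) : \bar R :=
  ereal_inf [set sigma%:E | sigma in
    [set sigma : R | mu [set x | sigma%:E < `|h x|] <= t%:E]].

(* f_y^*(x, t) *)
Definition rearrangement_y (f : R * R -> R) (x t : R) : \bar R :=
  decreasing_rearrangement (fun y => (f (x, y))%:E) t.

(* f_yx^*(s, t) *)
Definition rearrangement_yx (f : R * R -> R) (s t : R) : \bar R :=
  decreasing_rearrangement (fun x => rearrangement_y f x t) s.

(* Measurability in the sense of Lebesgue: the domain carries the completion
   of the Borel sigma-algebra of the plane for the product measure. *)
Definition lebesgue_measurable2 (f : R * R -> R) : Prop :=
  measurable_fun [set: g_sigma_algebraType (completed_algebra_gen (mu \x mu))]
    (f : g_sigma_algebraType (completed_algebra_gen (mu \x mu)) -> R).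

(* Lambda_2^p(ab) *)
Definition Lambda2 (p : R) (a b : R -> R) : set (R * R -> R) :=
  [set f | lebesgue_measurable2 f /\
    (\int[mu]_(t in `]0%R, +oo[) \int[mu]_(s in `]0%R, +oo[)
       (rearrangement_yx f s t `^ p * (a s)%:E * (b t)%:E)) `^ p^-1 < +oo].

(* Lambda^p(a)[Lambda^p(b)] *)
Definition LambdaMixed (p : R) (a b : R -> R) : set (R * R -> R) :=
  [set f | lebesgue_measurable2 f /\
    (\int[mu]_(s in `]0%R, +oo[)
       (decreasing_rearrangement
          (fun x => \int[mu]_(t in `]0%R, +oo[)
                      (rearrangement_y f x t `^ p * (b t)%:E)) s
        * (a s)%:E)) `^ p^-1 < +oo].

End Rearrangements.

(* Main.v *)
Require Import Defs.
From HB Require Import structures.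
From mathcomp Require Import all_boot all_order all_algebra.
From mathcomp Require Import all_classical all_reals all_analysis.
From mathcomp Require Import measurable_realfun lra.

Import Order.TTheory GRing.Theory Num.Theory.
Import numFieldNormedType.Exports.

Local Open Scope classical_set_scope.
Local Open Scope ring_scope.

(** Put g_t(x) = f_y^*(x, t)^p.  Since rearranging commutes with the power p,
    the quantity that defines Lambda_2^p(uv) is
    int_0^oo (int_0^1 (g_t)^*(s) ds) dt, and the one that defines
    Lambda^p(u)[Lambda^p(v)] is int_0^1 (int_0^oo g_t dt)^*(s) ds.

    Inclusion.  The functional h |-> int_0^1 h^* is a K-functional between L^1
    and L^oo, so the second quantity is at most the first
    ([rearrangement_integral_le]).  With l_t = (g_t)^*(1), the integral
    F = int g_t dt is at most L + G, where L = int l_t dt and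
    G = int (g_t - l_t)_+ dt.  Then int_0^1 F^* <= L + int G
    ([integral_rearrangement_le]); Tonelli turns the right-hand side into
    int (l_t + int (g_t - l_t)_+ dx) dt, and
    l_t + int (g_t - l_t)_+ dx <= int_0^1 (g_t)^* ([le_integral_rearrangement]).
    The two bounds with int_0^1 come from the layer-cake formula, that is, from
    a comparison of distribution functions ([le_integral_distribution]).
    A Lebesgue measurable f is first replaced by a Borel function equal to f
    almost everywhere; for almost every x the sections f(x, .) then agree up to
    a null set, and have the same rearrangement ([lebesgue_measurable2_sections]).

    Strictness.  Let f(x, y) = x^(-1/p) for 0 < y < x, and 0 elsewhere.  Every
    section has int f(x, .)^p = 1 or 0, so f is in Lambda^p(u)[Lambda^p(v)];
    but f_yx^*(s, t)^p >= 1/(t + 2) for s <= 1, which is not integrable in t.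

    Failure of the other inclusion.  The indicator of R x [0, 2] has
    f_yx^*(s, t) = 1 for t < 2 and 0 for t >= 2, hence is in Lambda_2^p(uv);
    but int_0^1 f_y^*(x, t)^p dt = 1 for all x, and the rearrangement of the
    constant 1 is not integrable over the half-line. *)

(** * Decreasing rearrangements *)

Section DecreasingRearrangement.
Set Implicit Arguments.
Unset Strict Implicit.
Context {R : realType}.
Local Open Scope ereal_scope.
Local Notation mu := (@lebesgue_measure R).
Local Notation DR := (@decreasing_rearrangement R).
Implicit Types (A B N : set R) (h k : R -> \bar R) (s t c : R).

Lemma le_lebesgue_measure A B : A `<=` B -> mu A <= mu B.
Proof. exact: (@le_outer_measure _ _ ((wlength idfun)^*)%mu). Qed.

Lemma lebesgue_measure_le_negligible A B N :
  mu.-negligible N -> A `\` N `<=` B -> mu A <= mu B.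
Proof.
move=> [M [mM M0 NM]] ANB.
rewrite -[leRHS]adde0 -M0.
apply: (@le_trans _ _ (mu (B `|` M))); last first.
  exact: (@outer_measureU2 _ _ ((wlength idfun)^*)%mu).
apply: le_lebesgue_measure => x Ax.
by have [/NM Mx|Nx] := pselect (N x); [right|left; apply: ANB].
Qed.

Lemma lebesgue_measure_setT : mu [set: R] = +oo.
Proof. by rewrite -set_itvNyy lebesgue_measure_itv. Qed.

Lemma rearrangement_ge0 h t : 0 <= DR h t.
Proof.
apply: le_ereal_inf_tmp => _ [c /= hc <-]; rewrite lee_fin.
rewrite leNgt; apply/negP => c0.
move: hc; rewrite (_ : [set _ | _] = setT) ?lebesgue_measure_setT ?leye_eq//.
by apply/seteqP; split => // x _ /=; rewrite (@lt_le_trans _ _ 0) ?lte_fin.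
Qed.

Lemma rearrangement_le h t c :
  mu [set x | c%:E < `|h x|] <= t%:E -> DR h t <= c%:E.
Proof. by move=> hc; apply: ereal_inf_lbound; exists c. Qed.

Lemma lt_rearrangement h t c : DR h t < c%:E ->
  exists2 d, (d < c)%R & mu [set x | d%:E < `|h x|] <= t%:E.
Proof.
by move/ereal_inf_lt => [_ [d /= hd <-]]; rewrite lte_fin => dc; exists d.
Qed.

Lemma rearrangement_lt h t c :
  DR h t < c%:E -> mu [set x | c%:E < `|h x|] <= t%:E.
Proof.
move=> /lt_rearrangement[d dc]; apply: le_trans.
apply: le_lebesgue_measure => x /=; apply: lt_trans.
by rewrite lte_fin.
Qed.

(** A lower bound for |h| on a set of measure larger than t bounds h^*(t). *)
Lemma rearrangement_ge A h t (c : \bar R) : t%:E < mu A ->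
  (forall x, A x -> c <= `|h x|) -> c <= DR h t.
Proof.
move=> tA Ah; apply: le_ereal_inf_tmp => _ [d /= hd <-].
rewrite leNgt; apply/negP => dc.
move: hd; rewrite leNgt => /negP; apply.
apply: (lt_le_trans tA); apply: le_lebesgue_measure => x /Ah.
exact: lt_le_trans.
Qed.

Lemma rearrangement_antitone h s t : (s <= t)%R -> DR h t <= DR h s.
Proof.
move=> st; apply: ereal_inf_le_tmp => _ [c /= hc <-].
by exists c => //=; rewrite (le_trans hc)// lee_fin.
Qed.

(** The values of h on a null set do not matter, and h and k need not be
    measurable, because [lebesgue_measure] is an outer measure. *)
Lemma rearrangement_le_ae N h k t : mu.-negligible N ->
  (forall x, ~ N x -> `|h x| <= `|k x|) -> DR h t <= DR k t.
Proof.
move=> N0 hk; apply: ereal_inf_le_tmp => _ [c /= kc <-].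
exists c => //=; apply: le_trans kc.
apply: lebesgue_measure_le_negligible N0 _ => x [/= ch /hk].
exact: lt_le_trans.
Qed.

Lemma rearrangement_homo h k t :
  (forall x, `|h x| <= `|k x|) -> DR h t <= DR k t.
Proof. move=> hk; apply: (@rearrangement_le_ae set0) => [|x _]; last exact: hk.
exact: negligible_set0. Qed.

Lemma rearrangement_eq_ae N h k t : mu.-negligible N ->
  (forall x, ~ N x -> h x = k x) -> DR h t = DR k t.
Proof.
move=> N0 hk; apply/le_anti.
by rewrite !(rearrangement_le_ae _ N0)// => x /hk ->.
Qed.

Lemma rearrangement_addl h t (c : \bar R) : (forall x, 0 <= h x) -> 0 <= c ->
  DR (fun x => c + h x) t <= c + DR h t.
Proof.
move=> h0; case: c => [c c0||//]; last first.
  rewrite addye ?leey// gt_eqF//.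
  by rewrite (lt_le_trans _ (rearrangement_ge0 _ _))// ltNyr.
rewrite -leeBlDl//; apply: le_ereal_inf_tmp => _ [d /= hd <-].
rewrite EFinN leeBlDl// -EFinD; apply: rearrangement_le; apply: le_trans hd.
apply: le_lebesgue_measure => x /=.
by rewrite !gee0_abs ?adde_ge0// EFinD lteD2lE.
Qed.

Lemma rearrangement_poweR_le (p : R) h t : (0 < p)%R -> (forall x, 0 <= h x) ->
  DR (fun x => h x `^ p) t <= DR h t `^ p.
Proof.
move=> p0 h0; have pN0 : p != 0%R by rewrite gt_eqF.
apply/lee_addgt0Pr => e e0.
have := rearrangement_ge0 h t.
case E : (DR h t) => [r||]// r0; last by rewrite poweRyr// addye ?leey.
rewrite poweR_EFin -EFinD; apply: rearrangement_le.
(* {h^p > c} = {h > c^(1/p)}, and h^*(t) < c^(1/p) *)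
set c := (_ + _)%R.
have c0 : (0 < c)%R by rewrite (lt_le_trans e0)// lerDr powR_ge0.
have rc : DR h t < (c `^ p^-1)%:E.
  rewrite E lte_fin -[ltLHS](@powRr1 _ r) ?lee_fin// -(mulfV pN0) powRrM.
  by rewrite gt0_ltr_powR ?invr_gt0 ?nnegrE ?powR_ge0 ?ltrDl// ltW.
apply: le_trans (rearrangement_lt rc).
apply: le_lebesgue_measure => x /=.
rewrite !gee0_abs ?poweR_ge0//; have := h0 x.
case: (h x) => [y||]//; last by rewrite ltry.
rewrite poweR_EFin !lte_fin lee_fin => y0 cy.
rewrite -[ltRHS](@powRr1 _ y)// -(mulfV pN0) powRrM.
by rewrite gt0_ltr_powR ?invr_gt0 ?nnegrE ?powR_ge0// ltW.
Qed.

Lemma le_poweR (p : R) (x y : \bar R) : (0 < p)%R -> 0 <= x -> x <= y ->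
  x `^ p <= y `^ p.
Proof.
move=> p0 x0 xy; apply: gt0_ler_poweR => //; first exact: ltW.
  by rewrite in_itv/= x0 leey.
by rewrite in_itv/= (le_trans x0 xy) leey.
Qed.

Lemma poweRK (p : R) (x : \bar R) : p != 0%R -> 0 <= x -> x `^ p `^ p^-1 = x.
Proof. by move=> p0 x0; rewrite -poweRrM divff// poweRe1. Qed.

Lemma rearrangement_poweR (p : R) h t : (0 < p)%R -> (forall x, 0 <= h x) ->
  DR (fun x => h x `^ p) t = DR h t `^ p.
Proof.
move=> p0 h0; apply/le_anti; rewrite rearrangement_poweR_le//=.
have pN0 : p != 0%R by rewrite gt_eqF.
have q0 : (0 < p^-1)%R by rewrite invr_gt0.
rewrite -[leRHS](@poweRK p^-1) ?invr_eq0 ?rearrangement_ge0// invrK.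
apply: le_poweR => //; first exact: rearrangement_ge0.
apply: le_trans (rearrangement_poweR_le _ q0 _); last first.
  by move=> x; exact: poweR_ge0.
rewrite [X in _ <= DR X _](_ : _ = h)//.
by apply/funext => x; rewrite poweRK.
Qed.

(** The infimum in the definition of h^*(t) is attained: the distribution
    function of a measurable h is right-continuous. *)
Lemma rearrangement_leP h t c : measurable_fun setT h ->
  DR h t <= c%:E <-> mu [set x | c%:E < `|h x|] <= t%:E.
Proof.
move=> mh; split; last exact: rearrangement_le.
move=> htc; pose F n := [set x | (c + n.+1%:R^-1)%:E < `|h x|].
have mF n : measurable (F n).
  rewrite /F -[X in measurable X]setTI.
  by apply: emeasurable_fun_o_infty => //; exact: measurableT_comp.
have FE : [set x | c%:E < `|h x|] = \bigcup_n F n.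
  apply/seteqP; split => [x /=|x [n _] /=]; last first.
    by apply: lt_trans; rewrite lte_fin ltrDl.
  rewrite /F /bigcup/=.
  case: `|h x| => [y||]//; last by move=> _; exists 0%N; rewrite //= ltry.
  by rewrite lte_fin => /ltr_add_invr[n cny]; exists n.
rewrite FE.
have ndF : nondecreasing_seq F.
  apply/nondecreasing_seqP => n; apply/subsetPset => x; apply: le_lt_trans.
  by rewrite lee_fin lerD2l lef_pV2 ?posrE// ler_nat.
have FU : mu (F n) @[n --> \oo] --> mu (\bigcup_n F n).
  by apply: nondecreasing_cvg_mu => //; exact: bigcupT_measurable.
rewrite -(cvg_lim _ FU)//; apply: lime_le.
  by apply/cvg_ex; eexists; exact: FU.
apply: nearW => n; apply: rearrangement_lt; apply: (le_lt_trans htc).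
by rewrite lte_fin ltrDl.
Qed.

Lemma nonincreasing_emeasurable (D : set R) h :
  measurable D -> {homo h : x y / (x <= y)%R >-> y <= x} -> measurable_fun D h.
Proof.
move=> mD hh; apply: (measurability _ (ErealGenOInfty.measurableE R)).
move=> /= _ [_ [r ->] <-].
apply: measurableI => //; apply: is_interval_measurable => s t/=.
rewrite !in_itv/= !andbT => rs rt u /andP[su ut].
by rewrite in_itv/= andbT (lt_le_trans rt)// hh.
Qed.

Lemma measurable_rearrangement D h : measurable D -> measurable_fun D (DR h).
Proof.
move=> mD; apply: nonincreasing_emeasurable => // s t.
exact: rearrangement_antitone.
Qed.

End DecreasingRearrangement.

(** * The layer-cake formula *)

Section LayerCake.
Set Implicit Arguments.
Unset Strict Implicit.
Context {R : realType}.
Local Open Scope ereal_scope.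
Local Notation mu := (@lebesgue_measure R).

Lemma layer_cake d (T : measurableType d)
    (m : {sigma_finite_measure set T -> \bar R}) (f : T -> \bar R) :
  measurable_fun setT f -> (forall x, 0 <= f x) ->
  \int[m]_x f x = \int[mu]_(r in `]0%R, +oo[) m [set x | r%:E < f x].
Proof.
move=> mf f0.
(* the part of the subgraph of f above 0, measured along both coordinates *)
pose E : set (T * R) := [set z | (0 < z.2)%R] `&` [set z | z.2%:E < f z.1].
have mE : measurable E.
  apply: measurableI.
  - rewrite -[X in measurable X]setTI.
    rewrite (_ : [set _ | _] = [set z | 0%:E < z.2%:E]); last first.
      by apply/seteqP; split => z /=; rewrite lte_fin.
    by apply: measurable_lte => //; exact/measurable_EFinP.
  - rewrite -[X in measurable X]setTI; apply: measurable_lte => //.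
    + exact/measurable_EFinP.
    + exact: measurableT_comp.
have xE x : mu (xsection E x) = f x.
  have := f0 x.
  rewrite (_ : xsection E x = [set r | 0 < r%:E < f x]); last first.
    apply/seteqP; split => r; rewrite /xsection/= inE /E/= lte_fin.
      by move=> [-> ->].
    by move=> /andP[].
  case: (f x) => [r||]// r0.
  - rewrite (_ : [set _ | _] = `]0%R, r[%classic); last first.
      by apply/seteqP; split => s /=; rewrite in_itv/= !lte_fin.
    rewrite lebesgue_measure_itv/= lte_fin; case: ltP => r0'.
      by rewrite oppr0 adde0.
    by apply/eqP; rewrite eq_le r0 lee_fin r0'.
  - rewrite (_ : [set _ | _] = `]0%R, +oo[%classic); last first.
      by apply/seteqP; split => s /=; rewrite in_itv/= lte_fin ltry.
    by rewrite lebesgue_measure_itv/= ltry.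
have yE r : m (ysection E r) =
    ((fun r => m [set x | r%:E < f x]) \_ `]0%R, +oo[) r.
  rewrite patchE; case: ifPn; rewrite ?inE ?notin_setE/= in_itv/= andbT => r0.
    congr (m _); apply/seteqP; split => x; rewrite /ysection/= inE /E/=.
      by case.
    by split.
  rewrite (_ : ysection E r = set0) ?measure0//.
  by apply/seteqP; split => x //; rewrite /ysection/= inE /E/= => -[].
transitivity (\int[m]_x (mu \o xsection E) x).
  by apply: eq_integral => x _ /=; rewrite xE.
rewrite [RHS]integral_mkcond.
transitivity (\int[mu]_r (m \o ysection E) r); last first.
  by apply: eq_integral => r _ /=; rewrite yE.
rewrite -indic_fubini_tonelli_FE// -indic_fubini_tonelli_GE//.
exact: indic_fubini_tonelli.
Qed.

Lemma measurable_distribution d (T : measurableType d)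
    (m : {measure set T -> \bar R}) (f : T -> \bar R) (D : set R) :
  measurable D -> measurable_fun setT f ->
  measurable_fun D (fun r => m [set x | r%:E < f x]).
Proof.
move=> mD mf; apply: nonincreasing_emeasurable => // r s rs.
apply: le_measure; rewrite ?inE.
- by rewrite -[X in measurable X]setTI; exact: emeasurable_fun_o_infty.
- by rewrite -[X in measurable X]setTI; exact: emeasurable_fun_o_infty.
- by move=> x /=; apply: le_lt_trans; rewrite lee_fin.
Qed.

Lemma le_integral_distribution d1 d2 (T1 : measurableType d1)
    (T2 : measurableType d2) (m1 : {sigma_finite_measure set T1 -> \bar R})
    (m2 : {sigma_finite_measure set T2 -> \bar R})
    (f : T1 -> \bar R) (g : T2 -> \bar R) :
  measurable_fun setT f -> (forall x, 0 <= f x) ->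
  measurable_fun setT g -> (forall x, 0 <= g x) ->
  (forall r, (0 < r)%R -> m1 [set x | r%:E < f x] <= m2 [set x | r%:E < g x]) ->
  \int[m1]_x f x <= \int[m2]_x g x.
Proof.
move=> mf f0 mg g0 fg; rewrite !layer_cake//.
apply: ge0_le_integral => //.
- exact: measurable_distribution.
- exact: measurable_distribution.
by move=> r/=; rewrite in_itv/= andbT; exact: fg.
Qed.

End LayerCake.

(** * Integrals of rearrangements over the unit interval *)

Section Averages.
Set Implicit Arguments.
Unset Strict Implicit.
Context {R : realType}.
Local Open Scope ereal_scope.
Local Notation mu := (@lebesgue_measure R).
Local Notation DR := (@decreasing_rearrangement R).
Implicit Types (g : R -> \bar R).

Lemma integral_unit_cst (k : \bar R) : \int[mu]_(s in `]0%R, 1%R]) k = k.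
Proof.
transitivity (k * mu `]0%R, 1%R]); first exact: integral_cst.
by rewrite lebesgue_measure_itv/= lte01 oppr0 adde0 mule1.
Qed.

(** On (0, 1], the set where g^* > r is contained in (0, c), where c is the
    measure of the set where g > r. *)
Lemma integral_rearrangement_le g : measurable_fun setT g ->
  (forall x, 0 <= g x) -> \int[mu]_(s in `]0%R, 1%R]) DR g s <= \int[mu]_x g x.
Proof.
move=> mg g0; rewrite integral_mkcond; apply: le_integral_distribution => //.
- by apply/(measurable_restrictT _ _).1 => //; exact: measurable_rearrangement.
- by move=> x; apply: erestrict_ge0 => s _; exact: rearrangement_ge0.
move=> r r0; rewrite -[leRHS]/(mu [set x | r%:E < g x]) -[leLHS]/(mu _).
have [->|] := eqVneq (mu [set x | r%:E < g x]) +oo; first exact: leey.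
have : 0 <= mu [set x | r%:E < g x] by exact: measure_ge0.
case E : (mu [set x | r%:E < g x]) => [c||]// c0 _.
apply: (@le_trans _ _ (mu `]0%R, c[)); last first.
  by rewrite lebesgue_measure_itv/=; case: ifPn => _; rewrite ?oppr0 ?adde0.
apply: le_lebesgue_measure => s /=; rewrite patchE; case: ifPn; last first.
  by rewrite lte_fin ltNge ltW.
rewrite inE/= !in_itv/= => /andP[-> _] rs /=; rewrite ltNge; apply/negP => cs.
move: rs; rewrite ltNge => /negP; apply; apply: rearrangement_le.
rewrite (_ : [set _ | _] = [set x | r%:E < g x]) ?E ?lee_fin//.
by apply/seteqP; split => x /=; rewrite gee0_abs.
Qed.

(** If l = g^*(1) is finite, then g exceeds l only on a set of measure at most
    1, so (g - l)_+ on the line and g^* - l on (0, 1] are equimeasurable. *)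
Lemma le_integral_rearrangement g : measurable_fun setT g ->
  (forall x, 0 <= g x) ->
  DR g 1 + \int[mu]_x maxe (g x - DR g 1) 0
    <= \int[mu]_(s in `]0%R, 1%R]) DR g s.
Proof.
move=> mg g0; set l := DR g 1.
have lDR s : `]0%R, 1%R]%classic s -> l <= DR g s.
  by rewrite /= in_itv/= => /andP[_ s1]; exact: rearrangement_antitone.
have l0 : 0 <= l by exact: rearrangement_ge0.
have mDR := @measurable_rearrangement R `]0%R, 1%R] g (measurable_itv _).
have lI : l <= \int[mu]_(s in `]0%R, 1%R]) DR g s.
  rewrite -[leLHS]integral_unit_cst.
  by apply: ge0_le_integral => // s ?; exact: lDR.
have [loo|] := eqVneq l +oo.
  by rewrite (le_trans (leey _))// -loo.
case El : l l0 lDR lI => [r||]// r0 lDR lI _.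
have -> : \int[mu]_(s in `]0%R, 1%R]) DR g s =
    \int[mu]_(s in `]0%R, 1%R]) (r%:E + (DR g s - r%:E)).
  by apply: eq_integral => s _; rewrite addeC subeK.
rewrite ge0_integralD//; last 2 first.
- by move=> s /lDR; rewrite sube_ge0.
- exact: emeasurable_funB.
rewrite integral_unit_cst leeD2l// [leRHS]integral_mkcond.
apply: le_integral_distribution.
- by apply: measurable_maxe => //; exact: emeasurable_funB.
- by move=> x; rewrite le_max lexx orbT.
- by apply/(measurable_restrictT _ _).1 => //; exact: emeasurable_funB.
- by move=> x; apply: erestrict_ge0 => s /lDR; rewrite sube_ge0.
move=> t t0; set c := (r + t)%R.
have -> : [set x | t%:E < maxe (g x - r%:E) 0] = [set x | c%:E < `|g x|].
  apply/seteqP; split => x /=;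
    by rewrite lt_max (lte_fin t 0) (ltNge t) (ltW t0) orbF gee0_abs// EFinN
               lteBrDl// EFinD.
rewrite -[leLHS]/(mu _) -[leRHS]/(mu _).
have D1 : mu [set x | c%:E < `|g x|] <= 1%:E.
  by apply: rearrangement_lt; rewrite -/l El lte_fin ltrDl.
have : 0 <= mu [set x | c%:E < `|g x|] by exact: measure_ge0.
case E : (mu [set x | c%:E < `|g x|]) D1 => [b||]//; rewrite !lee_fin => b1 b0.
(* b <= 1 is the measure of the set where g > c, and g^* > c on (0, b) *)
rewrite (_ : b%:E = mu `]0%R, b[).
  apply: le_lebesgue_measure => s /=; rewrite in_itv/= => /andP[s0 sb].
  rewrite patchE mem_set/= ?in_itv/= ?s0 ?(ltW (lt_le_trans sb b1))//.
  rewrite EFinN lteBrDl// -EFinD -/c ltNge; apply/negP => /rearrangement_leP.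
  by rewrite E lee_fin leNgt sb => /(_ mg).
rewrite lebesgue_measure_itv/= lte_fin.
case: ltP; rewrite ?oppr0 ?adde0// => b0'.
by congr EFin; apply/le_anti/andP.
Qed.

End Averages.

(** * Subadditivity of the rearrangement over the unit interval *)

Section Minkowski.
Set Implicit Arguments.
Unset Strict Implicit.
Context {R : realType} d (T : measurableType d).
Local Open Scope ereal_scope.
Local Notation mu := (@lebesgue_measure R).
Local Notation DR := (@decreasing_rearrangement R).
Implicit Types (g : T * R -> \bar R).

Lemma measurable_rearrangement_pair g : measurable_fun setT g ->
  measurable_fun setT (fun z : T * R => DR (fun x => g (z.1, x)) z.2).
Proof.
move=> mg; apply: (measurability _ (ErealGenInftyO.measurableE R)).
move=> /= _ [_ [r ->] <-]; rewrite setTI.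
(* h^*(s) < r iff some rational q < r has |{|h| > q}| <= s *)
pose A (q : rat) : set (T * R) := [set z | (ratr q)%:E < `|g z|].
have mA q : measurable (A q).
  rewrite /A -[X in measurable X]setTI.
  by apply: emeasurable_fun_o_infty => //; exact: measurableT_comp.
pose B (q : rat) : set (T * R) := if (ratr q < r)%R
  then [set z | mu (xsection (A q) z.1) <= z.2%:E] else set0.
rewrite (_ : _ @^-1` _ = \bigcup_q B q).
  apply: bigcupT_measurable_rat => q; rewrite /B; case: ifPn => // _.
  rewrite -[X in measurable X]setTI; apply: measurable_lee => //.
  - have := measurable_fun_xsection mu (mA q).
    by move=> m; exact: (measurableT_comp m).
  - exact/measurable_EFinP.
have AE q t : xsection (A q) t = [set x | (ratr q)%:E < `|g (t, x)|].
  by apply/seteqP; split => x; rewrite /xsection/= inE.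
apply/seteqP; split => [[t s]|[t s] [q _]]; rewrite /B /= in_itv/=.
  move=> /lt_rearrangement[c cr cs].
  have [q] := rat_in_itvoo cr; rewrite in_itv/= => /andP[cq qr].
  exists q => //; rewrite /B qr/= AE; apply: le_trans cs.
  by apply: le_lebesgue_measure => x /=; apply: lt_trans; rewrite lte_fin.
case: ifPn => // qr; rewrite /= AE => /rearrangement_le.
by move=> /le_lt_trans; apply; rewrite lte_fin.
Qed.

Context (m : {sigma_finite_measure set T -> \bar R}).

(** Minkowski inequality for h |-> int_0^1 h^*. *)
Lemma rearrangement_integral_le g (D : set T) : measurable D ->
  measurable_fun setT g -> (forall z, 0 <= g z) ->
  \int[mu]_(s in `]0%R, 1%R]) DR (fun x => \int[m]_(t in D) g (t, x)) s
  <= \int[m]_(t in D) \int[mu]_(s in `]0%R, 1%R]) DR (fun x => g (t, x)) s.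
Proof.
move=> mD mg g0.
have mgx x : measurable_fun setT (fun t => g (t, x)).
  exact: (measurableT_comp mg).
have mgt t : measurable_fun setT (fun x => g (t, x)).
  exact: (measurableT_comp mg).
pose l t := DR (fun x => g (t, x)) 1.
have l0 t : 0 <= l t by exact: rearrangement_ge0.
have ml : measurable_fun setT l.
  have := measurableT_comp (measurable_rearrangement_pair mg)
    (@pair2_measurable _ _ T R 1%R).
  exact.
pose K z := maxe (g z - l z.1) 0.
have K0 z : 0 <= K z by rewrite le_max lexx orbT.
have mK : measurable_fun setT K.
  apply: measurable_maxe => //; apply: emeasurable_funB => //.
  exact: measurableT_comp.
have mKx x : measurable_fun setT (fun t => K (t, x)).
  exact: (measurableT_comp mK).
pose KD := K \_ (D `*` setT).
have KD0 z : 0 <= KD z by apply: erestrict_ge0.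
have mKD : measurable_fun setT KD.
  apply/(measurable_restrictT _ _).1; first exact: measurableX.
  exact: measurable_funS mK.
pose G x := \int[m]_t KD (t, x).
have KDE t x : KD (t, x) = ((fun t => K (t, x)) \_ D) t.
  rewrite /KD !patchE; case: ifPn; case: ifPn => //; rewrite ?inE ?notin_setE/=.
  - by move=> nD [].
  - by move=> Dt nD; exfalso; apply: nD.
have GE x : G x = \int[m]_(t in D) K (t, x).
  by rewrite [RHS]integral_mkcond; apply: eq_integral => t _; rewrite KDE.
have G0 x : 0 <= G x by exact: integral_ge0.
have mG : measurable_fun setT G.
  exact: (measurable_fun_fubini_tonelli_G _ mKD KD0).
pose L := \int[m]_(t in D) l t.
have L0 : 0 <= L by exact: integral_ge0.
have HLG x : \int[m]_(t in D) g (t, x) <= L + G x.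
  have mlD : measurable_fun D l by exact: measurable_funS ml.
  have mKD' : measurable_fun D (fun t => K (t, x)).
    exact: measurable_funS (mKx x).
  rewrite GE -ge0_integralD//.
  apply: ge0_le_integral => //.
  - exact: measurable_funS (mgx x).
  - exact: emeasurable_funD.
  move=> t _; rewrite /K/=; have := l0 t; case: (l t) => [r||]//= r0.
  - by rewrite -leeBlDl// le_max lexx.
  - rewrite addye ?leey// gt_eqF// (@lt_le_trans _ _ 0)// ?ltNyr//.
    by rewrite le_max lexx orbT.
have m01 (h : R -> \bar R) :
    measurable_fun (`]0%R, 1%R]%classic : set R) (DR h).
  exact: measurable_rearrangement.
apply: (@le_trans _ _ (\int[mu]_(s in `]0%R, 1%R]) (L + DR G s))).
  apply: ge0_le_integral => //.
  - by move=> s _; exact: rearrangement_ge0.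
  - exact: m01.
  - by apply: emeasurable_funD => //; exact: m01.
  move=> s _; apply: le_trans (rearrangement_addl s G0 L0).
  apply: rearrangement_homo => x.
  have I0 : 0 <= \int[m]_(t in D) g (t, x) by exact: integral_ge0.
  by rewrite (gee0_abs I0) (gee0_abs (adde_ge0 L0 (G0 x))).
rewrite ge0_integralD//; last 2 first.
- by move=> s _; exact: rearrangement_ge0.
- exact: m01.
rewrite integral_unit_cst.
apply: le_trans (leeD2l _ (integral_rearrangement_le mG G0)) _.
have -> : \int[mu]_x G x = \int[m]_(t in D) \int[mu]_x K (t, x).
  rewrite /G -(@fubini_tonelli _ _ _ _ _ m mu _ mKD KD0)// [RHS]integral_mkcond.
  apply: eq_integral => t _; rewrite patchE.
  under eq_integral do rewrite KDE patchE.
  by case: ifPn => // _; rewrite integral0.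
have mF : measurable_fun setT (fun t => \int[mu]_x K (t, x)).
  exact: (measurable_fun_fubini_tonelli_F (m2 := mu) _ mK K0).
rewrite -ge0_integralD//; last 3 first.
- exact: measurable_funS ml.
- by move=> t _; exact: integral_ge0.
- exact: measurable_funS mF.
apply: ge0_le_integral => //.
- by move=> t _; rewrite adde_ge0// integral_ge0.
- by apply: emeasurable_funD; [exact: measurable_funS ml
                              |exact: measurable_funS mF].
- pose P := (fun z : T * R => DR (fun x => g (z.1, x)) z.2)
    \_ (setT `*` `]0%R, 1%R]).
  have P0 z : 0 <= P z by apply: erestrict_ge0 => ? _; exact: rearrangement_ge0.
  have mP : measurable_fun setT P.
    apply/(measurable_restrictT _ _).1; first exact: measurableX.
    exact: measurable_funS (measurable_rearrangement_pair mg).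
  have mPF := measurable_fun_fubini_tonelli_F (m2 := mu) _ mP P0.
  rewrite (_ : (fun t => _) = fubini_F mu P); first exact: measurable_funS mPF.
  apply/funext => t; rewrite /fubini_F [LHS]integral_mkcond.
  rewrite -[RHS]/(\int[mu]_y P (t, y)).
  apply: eq_integral => s _; rewrite /P !patchE/=.
  case: ifPn; case: ifPn => //; rewrite ?inE ?notin_setE/=.
  - by move=> n1 n2; exfalso; apply: n1.
  - by move=> [_ ?].
move=> t _; exact: le_integral_rearrangement.
Qed.

End Minkowski.

(** * Passing from the completion to Borel functions *)

Section Completion.
Set Implicit Arguments.
Unset Strict Implicit.
Context {R : realType} d (T : measurableType d).
Context (m : {measure set T -> \bar R}).

Lemma completed_measurable_eq_ae (S : set T) :
  (completed_algebra_gen m).-sigma.-measurable S ->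
  exists A M, [/\ measurable A, measurable M, m M = 0%E &
    forall x, ~ M x -> S x <-> A x].
Proof.
move: S; apply: smallest_sub; last first.
  move=> _ [A mA [N [M [mM M0 NM]] <-]]; exists A, M; split => // x Mx.
  by split => [[//|/NM]|]; [|left].
split => /=.
- by exists set0, set0; split => //; exact: measure0.
- move=> S [A [M [mA mM M0 SA]]]; exists (~` A), M; split => //.
    exact: measurableC.
  by move=> x /SA Sx; split => [[_ nS] /Sx|nS]; [|split => // /Sx].
- move=> S /= /choice[A /choice[M AM]].
  exists (\bigcup_n A n), (\bigcup_n M n); split.
  + by apply: bigcupT_measurable => n; have [] := AM n.
  + by apply: bigcupT_measurable => n; have [] := AM n.
  + apply/negligibleP; first by apply: bigcupT_measurable => n; have [] := AM n.
    apply: negligible_bigcup => n.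
    by have [_ mMn Mn0 _] := AM n; exact/negligibleP.
  + move=> x Mx; split => -[n _ Sx]; exists n => //; have [_ _ _ SA] := AM n;
      by apply/SA => // Mn; apply: Mx; exists n.
Qed.

Lemma completed_measurable_fun_eq_ae (f : T -> R) :
  measurable_fun [set: g_sigma_algebraType (completed_algebra_gen m)]
    (f : g_sigma_algebraType (completed_algebra_gen m) -> R) ->
  exists (g : T -> R) (M : set T), [/\ measurable_fun setT g,
    measurable M, m M = 0%E & forall x, ~ M x -> f x = g x].
Proof.
move=> mf.
have /choice[A /choice[M AM]] (q : rat) : exists A M, [/\ measurable A,
    measurable M, m M = 0%E & forall x, ~ M x -> (f x < ratr q) <-> A x].
  apply: (@completed_measurable_eq_ae [set x | f x < ratr q]).
  rewrite (_ : [set x | f x < ratr q] = f @^-1` `]-oo, (ratr q)[); last first.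
    by apply/seteqP; split => x /=; rewrite in_itv.
  have := mf measurableT `]-oo, (ratr q)[%classic (measurable_itv _).
  by rewrite setTI.
pose N := \bigcup_q M q.
have mN : measurable N by apply: bigcupT_measurable_rat => q; have [] := AM q.
exists (f \_ (~` N)), N; split => //; last 2 first.
- apply/negligibleP => //.
  rewrite (_ : N = \bigcup_n oapp M set0 (unpickle n)).
    apply: negligible_bigcup => n; case: (unpickle n) => [q|]/=.
      by have [_ mMq Mq0 _] := AM q; exact/negligibleP.
    exact: negligible_set0.
  apply/seteqP; split => [x [q _ Mx]|x [n _]].
    by exists (pickle q); [done|rewrite pickleK; exact: Mx].
  by case: (unpickle n) => // q Mx; exists q.
- by move=> x Nx; rewrite patchE mem_set.
apply/(measurable_restrictT _ _).1; first exact: measurableC.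
apply: (measurability _ (RGenInftyO.measurableE R)) => /= _ [_ [r ->] <-].
pose B q := if ratr q < r then ~` N `&` A q else set0.
rewrite (_ : _ `&` _ = \bigcup_q B q).
  apply: bigcupT_measurable_rat => q; rewrite /B; case: ifPn => // _.
  by apply: measurableI; [exact: measurableC|have [] := AM q].
apply/seteqP; split => [x [Nx]|x [q _]]; rewrite /B /= in_itv/=.
  move=> fr; have [q] := rat_in_itvoo fr; rewrite in_itv/= => /andP[fq qr].
  exists q => //; rewrite /B qr; split => //.
  have [_ _ _ fA] := AM q; apply/fA => // Mq.
  by apply: Nx; exists q.
case: ifPn => // qr [Nx Ax]; split => //; apply: lt_trans qr.
have [_ _ _ fA] := AM q; apply/fA => // Mq.
by apply: Nx; exists q.
Qed.

End Completion.

(** * The inclusion *)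

Section Inclusion.
Set Implicit Arguments.
Unset Strict Implicit.
Context {R : realType}.
Local Open Scope ereal_scope.
Local Notation mu := (@lebesgue_measure R).
Local Notation DR := (@decreasing_rearrangement R).

Lemma integral_unit_weight (h : R -> \bar R) :
  \int[mu]_(s in `]0%R, +oo[) (h s * ((\1_`[0%R, 1%R] : R -> R) s)%:E) =
  \int[mu]_(s in `]0%R, 1%R]) h s.
Proof.
rewrite integral_mkcond [RHS]integral_mkcond; apply: eq_integral => s _.
rewrite !patchE indicE.
have [s0|s0] := ltP 0%R s; last first.
  by rewrite !memNset//= in_itv/= ltNge s0.
rewrite mem_set/= ?in_itv/= ?s0//.
have [s1|s1] := leP s 1%R.
  by rewrite !mem_set/= ?mule1// in_itv/= ?s0 ?s1 ?(ltW s0).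
by rewrite !memNset/= ?mule0// in_itv/= ?(ltW s0) ?s0/= leNgt s1.
Qed.

(** By Tonelli, almost every vertical section of a null set of the plane is
    null. *)
Lemma lebesgue_measurable2_sections (f : R * R -> R) :
  lebesgue_measurable2 f -> exists (g : R * R -> R) (N : set R),
  [/\ measurable_fun setT g, mu.-negligible N &
    forall x t, ~ N x -> rearrangement_y f x t = rearrangement_y g x t].
Proof.
move=> /completed_measurable_fun_eq_ae[g [M [mg mM M0 fg]]].
exists g, [set x | mu (xsection M x) <> 0]; split => //.
- have mx := measurable_fun_xsection mu mM.
  have : \int[mu]_x `|(mu \o xsection M) x| = 0.
    by rewrite -[RHS]M0; apply: eq_integral => x _; rewrite gee0_abs//=.
  move/(ae_eq_integral_abs _ measurableT mx).
  by apply: negligibleS => x /= Mx H; apply: Mx; exact: H.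
- move=> x t Mx.
  apply: (@rearrangement_eq_ae _ (xsection M x)).
    apply/negligibleP; first exact: measurable_xsection.
    exact: contrapT Mx.
  by move=> y; rewrite /xsection/= inE => /fg ->.
Qed.


Lemma Lambda2_sub_LambdaMixed (p : R) : (0 < p)%R ->
  Lambda2 p (\1_`[0%R, 1%R]) (cst 1%R) `<=`
  LambdaMixed p (\1_`[0%R, 1%R]) (cst 1%R).
Proof.
move=> p0 f [mf fL]; split => //.
have p1 : p^-1%R != 0%R by rewrite gt_eqF ?invr_gt0.
apply: poweR_lty; apply: le_lt_trans (lty_poweRy p1 fL).
have [g [N [mg N0 fg]]] := lebesgue_measurable2_sections mf.
rewrite integral_unit_weight.
have mEg : measurable_fun setT (fun z => (g z)%:E) by exact/measurable_EFinP.
pose r (z : R * R) := rearrangement_y g z.1 z.2.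
have mr : measurable_fun setT r by exact: (measurable_rearrangement_pair mEg).
have mrs : measurable_fun setT (fun z : R * R => r (z.2, z.1)).
  apply: (measurableT_comp mr).
  by apply: measurable_fun_pair; [exact: measurable_snd|exact: measurable_fst].
pose G (z : R * R) := rearrangement_y g z.2 z.1 `^ p.
have mG : measurable_fun setT G.
  exact: (measurableT_comp (measurable_poweR p) mrs).
have G0 z : 0 <= G z by exact: poweR_ge0.
have H := @rearrangement_integral_le R _ _ mu G
  (`]0%R, +oo[%classic : set R) (measurable_itv _) mG G0.
have eqW (x y : \bar R) : x = y -> x <= y by move=> ->.
apply: le_trans (le_trans H _); apply: eqW; apply: eq_integral.
  move=> s _; apply: rearrangement_eq_ae N0 _ => x Nx.
  by apply: eq_integral => t _; rewrite mule1 /G/= fg.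
move=> t _; under [RHS]eq_integral do rewrite mule1.
rewrite integral_unit_weight; apply: eq_integral => s _.
transitivity (DR (fun x => rearrangement_y g x t) s `^ p).
  exact: (@rearrangement_poweR R p (fun x => rearrangement_y g x t) s p0
    (fun x => rearrangement_ge0 _ _)).
suff -> : rearrangement_yx f s t = DR (fun x => rearrangement_y g x t) s by [].
by apply: rearrangement_eq_ae N0 _ => x Nx; exact: fg.
Qed.

End Inclusion.

(** * Bounds and measurability for iterated rearrangements *)

Section IteratedRearrangements.
Set Implicit Arguments.
Unset Strict Implicit.
Context {R : realType}.
Local Open Scope ereal_scope.
Local Notation mu := (@lebesgue_measure R).
Local Notation DR := (@decreasing_rearrangement R).
Implicit Types (f : R * R -> R) (h : R -> \bar R).

Lemma measurable_lebesgue_measurable2 f :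
  measurable_fun setT f -> lebesgue_measurable2 f.
Proof.
move=> mf _ Y mY; apply: sub_sigma_algebra.
exists (f @^-1` Y); first by rewrite -[_ @^-1` _]setTI; exact: mf.
by exists set0; [exact: negligible_set0|rewrite setU0 setTI].
Qed.

Lemma rearrangement_bounded h s (c : R) : (0 <= s)%R ->
  (forall x, `|h x| <= c%:E) -> DR h s <= c%:E.
Proof.
move=> s0 hc; apply: rearrangement_le; rewrite (_ : [set _ | _] = set0).
  by rewrite measure0 lee_fin.
by apply/seteqP; split => x //=; rewrite ltNge hc.
Qed.

Lemma rearrangement_y_ge0 f x t : 0 <= rearrangement_y f x t.
Proof. exact: rearrangement_ge0. Qed.

Lemma rearrangement_yx_ge0 f s t : 0 <= rearrangement_yx f s t.
Proof. exact: rearrangement_ge0. Qed.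

Lemma rearrangement_yx_antitone f s t t' : (t <= t')%R ->
  rearrangement_yx f s t' <= rearrangement_yx f s t.
Proof.
move=> tt; apply: rearrangement_homo => x.
rewrite !gee0_abs ?rearrangement_y_ge0//; exact: rearrangement_antitone.
Qed.

Lemma measurable_rearrangement_yx_poweR f p t (D : set R) : measurable D ->
  measurable_fun D (fun s => rearrangement_yx f s t `^ p).
Proof.
move=> mD; apply: (measurableT_comp (measurable_poweR p)).
exact: measurable_rearrangement.
Qed.

Lemma measurable_rearrangement_y_poweR f p x (D : set R) : measurable D ->
  measurable_fun D (fun t => rearrangement_y f x t `^ p).
Proof.
move=> mD; apply: (measurableT_comp (measurable_poweR p)).
exact: measurable_rearrangement.
Qed.

Lemma measurable_integral_rearrangement_yx f (p : R) (D : set R) :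
  measurable D -> (0 < p)%R ->
  measurable_fun D (fun t =>
    \int[mu]_(s in `]0%R, 1%R]) (rearrangement_yx f s t `^ p)).
Proof.
move=> mD p0; apply: nonincreasing_emeasurable; first exact: mD.
move=> t t' tt; apply: ge0_le_integral.
- exact: measurable_itv.
- by move=> s _; exact: poweR_ge0.
- exact: measurable_rearrangement_yx_poweR.
- exact: measurable_rearrangement_yx_poweR.
move=> s _; apply: le_poweR => //; first exact: rearrangement_yx_ge0.
exact: rearrangement_yx_antitone.
Qed.

Lemma Lambda2_unitE (p : R) f : (0 < p)%R ->
  Lambda2 p (\1_`[0%R, 1%R]) (cst 1%R) f <-> lebesgue_measurable2 f /\
  \int[mu]_(t in `]0%R, +oo[) \int[mu]_(s in `]0%R, 1%R])
    (rearrangement_yx f s t `^ p) < +oo.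
Proof.
move=> p0; rewrite /Lambda2/=.
under eq_integral do under eq_integral do rewrite mule1.
under eq_integral do rewrite integral_unit_weight.
split=> -[mf fL]; split => //; last exact: poweR_lty.
by apply: lty_poweRy fL; rewrite gt_eqF ?invr_gt0.
Qed.

(** Divergence of the harmonic integral, by dyadic blocks: the integral over
    (2^n, 2^(n+1)] is at least 1/4. *)
Lemma harmonic_integral_y h : measurable_fun (`]0%R, +oo[%classic : set R) h ->
  (forall t, (0 < t)%R -> ((t + 2)^-1)%:E <= h t) ->
  \int[mu]_(t in `]0%R, +oo[) h t = +oo.
Proof.
move=> mh hge.
have h0 t : (0 < t)%R -> 0 <= h t.
  move=> t0; apply: le_trans (hge t t0); rewrite lee_fin invr_ge0 addr_ge0//.
  exact: ltW.
have S n : (n%:R / 4)%:E <= \int[mu]_(t in `]0%R, (2 ^+ n)%R]) h t.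
  elim: n => [|n IH].
    rewrite mul0r; apply: integral_ge0 => t /=; rewrite in_itv/= => /andP[t0 _].
    exact: h0.
  have n0 : (0 < 2 ^+ n :> R)%R by rewrite exprn_gt0.
  have nn : (2 ^+ n <= 2 ^+ n.+1 :> R)%R by rewrite ler_eXn2l// ltr1n.
  have -> : `]0%R, (2 ^+ n.+1)%R]%classic =
     `]0%R, (2 ^+ n)%R] `|` `](2 ^+ n)%R, (2 ^+ n.+1)%R] :> set R.
    by rewrite -itv_bndbnd_setU// bnd_simp// ltW.
  rewrite ge0_integral_setU//=; last 3 first.
  - apply: measurable_funS mh => // t [] /=; rewrite !in_itv/= andbT.
      by move=> /andP[].
    move=> /andP[].
    by move=> + _; apply: lt_trans.
  - move=> t [] /=; rewrite in_itv/= => /andP[t0 _]; apply: h0 => //.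
    exact: lt_trans t0.
  - apply/disj_setPS => t /= []; rewrite !in_itv/= => /andP[_ tn] /andP[nt _].
    by move: nt; rewrite ltNge tn.
  rewrite -natr1 mulrDl EFinD leeD// div1r.
  have e : (4^-1 = (4 * 2 ^+ n)^-1 * 2 ^+ n :> R)%R.
    by rewrite invfM -mulrA mulVf ?mulr1// gt_eqF.
  rewrite e EFinM.
  apply: (@le_trans _ _ (\int[mu]_(t in `](2 ^+ n)%R, (2 ^+ n.+1)%R])
      ((4 * 2 ^+ n)^-1)%:E)).
    have mI : mu `](2 ^+ n)%R, (2 ^+ n.+1)%R] = (2 ^+ n)%:E.
      rewrite lebesgue_measure_itv/= lte_fin exprS ltr_pMl ?ltr1n//.
      by rewrite -EFinB mulr_natl mulr2n addrK.
    rewrite -mI le_eqVlt; apply/orP; left; apply/eqP/esym.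
    exact: integral_cst.
  apply: ge0_le_integral => //.
  - apply: measurable_funS mh => // t /=; rewrite !in_itv/= andbT => /andP[+ _].
    exact: lt_trans.
  move=> t /=; rewrite in_itv/= => /andP[nt tn].
  have t0 : (0 < t)%R by exact: lt_trans nt.
  apply: le_trans (hge t t0).
  rewrite lee_fin lef_pV2 ?posrE ?addr_gt0 ?mulr_gt0//.
  have n1 : (1 <= 2 ^+ n :> R)%R by rewrite exprn_ege1// ler1n.
  by move: tn; rewrite exprS; lra.
apply/eqyP => r r0; pose n := Num.bound (r * 4).
have rn : (r * 4 < n%:R)%R by rewrite archi_boundP// mulr_ge0// ltW.
apply: (@le_trans _ _ (n%:R / 4)%:E).
  by rewrite lee_fin ler_pdivlMr// ltW.
apply: le_trans (S n) _; apply: ge0_subset_integral => //.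
- by move=> t /=; rewrite in_itv/= andbT => /h0.
- by move=> t /=; rewrite !in_itv/= andbT => /andP[].
Qed.

End IteratedRearrangements.

(** * The two counterexamples *)

Section Counterexamples.
Set Implicit Arguments.
Unset Strict Implicit.
Context {R : realType}.
Local Open Scope ereal_scope.
Local Notation mu := (@lebesgue_measure R).
Local Notation DR := (@decreasing_rearrangement R).
Context (p : R) (p0 : (0 < p)%R).

(** The indicator of the strip R x [0, 2].  The height 2 exceeds 1 so that
    f_y^*(x, t) = 1 up to and including t = 1. *)
Definition strip (z : R * R) : R := \1_`[0%R, 2%R] z.2.

Lemma measurable_strip : measurable_fun setT strip.
Proof.
apply: (@measurableT_comp _ _ _ _ _ _ (\1_`[0%R, 2%R] : R -> R)) => //.
Qed.

Lemma rearrangement_y_strip_le x t : (0 <= t)%R ->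
  rearrangement_y strip x t <= (\1_`]-oo, 2%R[ t)%:E.
Proof.
move=> t0; rewrite indicE; have [t2|t2] := ltP t 2%R.
  rewrite mem_set/= ?in_itv//=; apply: rearrangement_bounded => // y.
  rewrite /strip indicE/=; case: (_ \in _);
    by rewrite /= ?normr1 ?normr0 ?lexx ?lee01.
rewrite memNset/=; last by rewrite in_itv/= ltNge t2.
apply: rearrangement_le; apply: (@le_trans _ _ (mu `[0%R, 2%R])); last first.
  by rewrite lebesgue_measure_itv/= lte_fin ltr0n/= oppr0 adde0 lee_fin.
apply: le_lebesgue_measure => y; rewrite /strip/= indicE.
by case: (boolP (y \in _)); rewrite ?inE//= normr0 ltxx.
Qed.

Lemma strip_Lambda2 : Lambda2 p (\1_`[0%R, 1%R]) (cst 1%R) strip.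
Proof.
apply/(Lambda2_unitE _ p0); split.
  by apply: measurable_lebesgue_measurable2; exact: measurable_strip.
apply: (@le_lt_trans _ _ (\int[mu]_(t in `]0%R, +oo[) (\1_`]-oo, 2%R[ t)%:E)).
  apply: ge0_le_integral.
  - exact: measurable_itv.
  - by move=> t _; apply: integral_ge0 => s _; exact: poweR_ge0.
  - exact: measurable_integral_rearrangement_yx.
  - by apply/measurable_EFinP; exact: measurable_indic.
  move=> t; rewrite /= in_itv/= andbT => /ltW t0.
  rewrite -[leRHS]integral_unit_cst; apply: ge0_le_integral.
  - exact: measurable_itv.
  - by move=> s _; exact: poweR_ge0.
  - exact: measurable_rearrangement_yx_poweR.
  - exact: measurable_cst.
  move=> s; rewrite /= in_itv/= => /andP[/ltW s0 _].
  have -> : (\1_`]-oo, 2%R[ t)%:E = (\1_`]-oo, 2%R[ t)%:E `^ p :> \bar R.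
    by rewrite indicE; case: (_ \in _); rewrite /= ?powR1 ?powR0 // gt_eqF.
  apply: le_poweR => //; first exact: rearrangement_ge0.
  apply: rearrangement_bounded => // x.
  by rewrite gee0_abs ?rearrangement_y_ge0//; exact: rearrangement_y_strip_le.
rewrite integral_indic//=; apply: (@le_lt_trans _ _ (mu `[0%R, 2%R])).
  apply: le_lebesgue_measure => t /= [].
  by rewrite !in_itv/= andbT => /ltW t2 /ltW t0; rewrite t0 t2.
by rewrite lebesgue_measure_itv/= lte_fin ltr0n/= oppr0 adde0 ltry.
Qed.

Lemma strip_notin_LambdaMixed :
  ~ LambdaMixed p (cst 1%R) (\1_`[0%R, 1%R]) strip.
Proof.
move=> [_] /(lty_poweRy _); rewrite gt_eqF ?invr_gt0// => /(_ isT).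
apply/negP; rewrite -leNgt leye_eq; apply/eqP/eqyP => r r0.
apply: (@le_trans _ _ (\int[mu]_(s in `]0%R, r]) 1)).
  have : \int[mu]_(s in `]0%R, r]) 1 = 1 * mu `]0%R, r] by exact: integral_cst.
  by move=> ->; rewrite mul1e lebesgue_measure_itv/= lte_fin r0 oppr0 adde0.
under [leRHS]eq_integral do rewrite mule1.
apply: (@le_trans _ _ (\int[mu]_(s in `]0%R, +oo[) 1)).
  apply: ge0_subset_integral => //.
  by move=> t /=; rewrite !in_itv/= andbT => /andP[].
apply: ge0_le_integral.
- exact: measurable_itv.
- by move=> ? _; exact: lee01.
- exact: measurable_cst.
- exact: measurable_rearrangement.
move=> s _; apply: (@rearrangement_ge _ setT).
  by rewrite lebesgue_measure_setT ltry.
move=> x _; rewrite integral_unit_weight gee0_abs; last first.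
  by apply: integral_ge0 => t _; exact: poweR_ge0.
rewrite -[leLHS]integral_unit_cst; apply: ge0_le_integral.
- exact: measurable_itv.
- by move=> ? _; exact: lee01.
- exact: measurable_cst.
- exact: measurable_rearrangement_y_poweR.
move=> t /=; rewrite in_itv/= => /andP[t0 t1].
have -> : 1 = 1 `^ p :> \bar R by rewrite poweR1r.
apply: le_poweR => //.
apply: (@rearrangement_ge _ `[0%R, 2%R]).
  rewrite lebesgue_measure_itv/= lte_fin ltr0n/= oppr0 adde0 lte_fin.
  by rewrite (le_lt_trans t1)// ltr1n.
by move=> y y02; rewrite /strip indicE mem_set//= normr1.
Qed.

(** x^(-1/p) on the sector 0 < y < x, and 0 elsewhere. *)
Definition hyperbolic (z : R * R) : R :=
  (z.1 `^ (- p^-1) * \1_([set z | 0 < z.2 < z.1]%R) z)%R.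

Lemma measurable_hyperbolic : measurable_fun setT hyperbolic.
Proof.
apply: measurable_funM.
  exact: (measurableT_comp (measurable_powR _)).
apply: measurable_indic.
rewrite (_ : [set _ | _] =
    [set z | 0%:E < z.2%:E] `&` [set z | z.2%:E < z.1%:E]).
  by apply: measurableI; rewrite -[X in measurable X]setTI;
    apply: measurable_lte => //; exact/measurable_EFinP.
by apply/seteqP; split => z /=; rewrite !lte_fin => /andP.
Qed.

Lemma hyperbolic_poweR (a : R) : (0 < a)%R ->
  (a `^ (- p^-1))%:E `^ p = (a^-1)%:E.
Proof.
move=> a0; rewrite poweR_EFin -powRrM mulNr mulVf ?gt_eqF//.
by rewrite powR_inv1// ltW.
Qed.

Lemma hyperbolic_notin_Lambda2 :
  ~ Lambda2 p (\1_`[0%R, 1%R]) (cst 1%R) hyperbolic.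
Proof.
move=> /(Lambda2_unitE _ p0)[_]; rewrite harmonic_integral_y//.
  exact: measurable_integral_rearrangement_yx.
move=> t t0; rewrite -[leLHS]integral_unit_cst; apply: ge0_le_integral.
- exact: measurable_itv.
- by move=> ? _; rewrite lee_fin invr_ge0 addr_ge0// ltW.
- exact: measurable_cst.
- exact: measurable_rearrangement_yx_poweR.
move=> s; rewrite /= in_itv/= => /andP[s0 s1].
(* (t, t + 2) has measure 2 > s, and f_y^*(x, t) = x^(-1/p) for x in it *)
rewrite -hyperbolic_poweR ?addr_gt0//; apply: le_poweR => //.
  by rewrite lee_fin powR_ge0.
apply: (@rearrangement_ge _ `]t, (t + 2)%R[).
  rewrite lebesgue_measure_itv/= lte_fin ltrDl ltr0n/= -EFinB lte_fin.
  by rewrite addrAC subrr add0r (le_lt_trans s1)// ltr1n.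
move=> x /=; rewrite in_itv/= => /andP[tx xt].
have x0 : (0 < x)%R by exact: lt_trans tx.
rewrite gee0_abs ?rearrangement_y_ge0//.
apply: (@rearrangement_ge _ `]0%R, x[).
  by rewrite lebesgue_measure_itv/= lte_fin x0 -EFinB subr0 lte_fin.
move=> y; rewrite /= in_itv/= => yx; rewrite /hyperbolic indicE mem_set//=.
rewrite mulr1 lee_fin ger0_norm ?powR_ge0// !powRN.
rewrite lef_pV2 ?posrE ?powR_gt0 ?addr_gt0//.
by apply: ge0_ler_powR; rewrite ?nnegrE ?invr_ge0 ?addr_ge0// ltW.
Qed.

Lemma rearrangement_y_hyperbolic_le x t : (0 < t)%R ->
  rearrangement_y hyperbolic x t `^ p
    <= ((cst (x^-1)%:E : R -> \bar R) \_ `]0%R, x[) t.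
Proof.
move=> t0; rewrite patchE; have [tx|xt] := ltP t x.
  rewrite mem_set/= ?in_itv/= ?t0//.
  rewrite -hyperbolic_poweR ?(lt_trans t0)//; apply: le_poweR => //.
    exact: rearrangement_y_ge0.
  apply: rearrangement_bounded; first exact: ltW.
  move=> y; rewrite /hyperbolic indicE /=; case: (_ \in _).
    by rewrite mulr1 ger0_norm ?powR_ge0.
  by rewrite mulr0 normr0 lee_fin powR_ge0.
rewrite memNset/=; last by rewrite in_itv/= t0/= ltNge xt.
suff -> : rearrangement_y hyperbolic x t = 0 by rewrite poweR0r// gt_eqF.
apply/le_anti; rewrite rearrangement_y_ge0 andbT.
apply: rearrangement_le; apply: (@le_trans _ _ (mu `]0%R, x[)); last first.
  rewrite lebesgue_measure_itv/= lte_fin.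
  case: ifPn => _; last by rewrite lee_fin ltW.
  by rewrite -EFinB subr0 lee_fin.
apply: le_lebesgue_measure => y; rewrite /hyperbolic/= indicE.
case: (boolP (_ \in _)); first by rewrite inE/= in_itv.
by rewrite mulr0 normr0 ltxx.
Qed.

Lemma hyperbolic_LambdaMixed :
  LambdaMixed p (\1_`[0%R, 1%R]) (cst 1%R) hyperbolic.
Proof.
split.
  by apply: measurable_lebesgue_measurable2; exact: measurable_hyperbolic.
apply: poweR_lty; rewrite integral_unit_weight.
apply: (@le_lt_trans _ _ 1); last exact: ltry.
rewrite -[leRHS]integral_unit_cst; apply: ge0_le_integral.
- exact: measurable_itv.
- by move=> s _; exact: rearrangement_ge0.
- exact: measurable_rearrangement.
- exact: measurable_cst.
move=> s; rewrite /= in_itv/= => /andP[/ltW s0 _].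
apply: rearrangement_bounded => // x.
under eq_integral do rewrite mule1.
rewrite gee0_abs; last by apply: integral_ge0 => t _; exact: poweR_ge0.
apply: (@le_trans _ _ (\int[mu]_(t in `]0%R, +oo[)
    ((cst (x^-1)%:E : R -> \bar R) \_ `]0%R, x[) t)).
  apply: ge0_le_integral.
  - exact: measurable_itv.
  - by move=> t _; exact: poweR_ge0.
  - exact: measurable_rearrangement_y_poweR.
  - apply: measurable_funTS; apply/(measurable_restrictT _ _).1 => //.
  move=> t; rewrite /= in_itv/= andbT => t0.
  exact: rearrangement_y_hyperbolic_le.
rewrite -integral_mkcondr.
have -> : `]0%R, +oo[%classic `&` `]0%R, x[%classic =
    `]0%R, x[%classic :> set R.
  apply/seteqP; split => t /=; rewrite !in_itv/= andbT; first by case.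
  by case/andP => -> ->.
have -> : \int[mu]_(t in `]0%R, x[) (cst (x^-1)%:E t) =
    (x^-1)%:E * mu `]0%R, x[.
  exact: integral_cst.
rewrite lebesgue_measure_itv/= lte_fin; case: ltP => x0; last by rewrite mule0.
by rewrite -EFinB subr0 -EFinM mulVf// gt_eqF.
Qed.

End Counterexamples.

Theorem mainTheorem5 (R : realType) (p : R) (p_gt0 : 0 < p) :
  let u : R -> R := \1_`[0, 1] in
  let v : R -> R := cst 1 in
  [/\ Lambda2 p u v `<` LambdaMixed p u v,
      ~ (Lambda2 p u v `<=` LambdaMixed p v u)
    & [/\ Lambda2 p u v <> LambdaMixed p u v,
          Lambda2 p u v <> LambdaMixed p v u
        & LambdaMixed p u v <> LambdaMixed p v u]].
Proof.
move=> u v.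
have sub : Lambda2 p u v `<=` LambdaMixed p u v.
  exact: Lambda2_sub_LambdaMixed.
have nuv : ~ (LambdaMixed p u v `<=` Lambda2 p u v).
  move=> /(_ _ (hyperbolic_LambdaMixed p_gt0)).
  exact: hyperbolic_notin_Lambda2.
have nvu : ~ (Lambda2 p u v `<=` LambdaMixed p v u).
  move=> /(_ _ (strip_Lambda2 p_gt0)).
  exact: strip_notin_LambdaMixed.
split => //; split => E.
- by apply: nuv; rewrite E.
- by apply: nvu; rewrite E.
- by apply: nvu; rewrite -E.
Qed.
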